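(* Let $G\in\mathbb{R}^{n\times n}$, $C:=\{X\in\mathbb{R}^{n\times n}\mid X\ge0\}$, $b:=[e^T\ e^T]^T\in\mathbb{R}^{2n}$, and consider \[ \min\Big\{\varphi(y):=\tfrac12\|\Pi_C(\mathcal{B}^*y+G)\|^2-\langle b,y\rangle-\tfrac12\|G\|^2\ \Big|\ y\in\mathrm{Ran}(\mathcal{B})\Big\}. \] Let $\{y^j\}$ be the infinite sequence generated by Algorithm SSNCG1 described in the context. Then $\{y^j\}\subseteq\mathrm{Ran}(\mathcal{B})$ is bounded, and any accumulation point $\hat y\in\mathrm{Ran}(\mathcal{B})$ of $\{y^j\}$ is an optimal solution of this minimization problem.
   Context: $e\in\mathbb{R}^n$ is the all-ones vector, $\|\cdot\|$ is the Frobenius/Euclidean norm, $\Pi_C$ is the projection onto $C$ (entrywise positive part). $\mathcal{B}:\mathbb{R}^{n\times n}\to\mathbb{R}^{2n}$, $\mathcal{B}(X)=[(Xe)^T\ (X^Te)^T]^T$, with adjoint $\mathcal{B}^*(y_1,y_2)=y_1e^T+ey_2^T$; $\mathrm{Ran}(\mathcal{B})$ is its range. The gradient is $\nabla\varphi(y)=\mathcal{B}\Pi_C(\mathcal{B}^*y+G)-b$. For $X\in\mathbb{R}^{n\times n}$ let $\Omega^X_{ij}=1$ if $X_{ij}\ge0$ and $0$ otherwise, and $\mathcal{U}(H)=\Omega^X\circ H$ ($\circ$ the Hadamard product). Algorithm SSNCG1: given $\mu\in(0,1/2)$, $\bar\eta\in(0,1)$, $\tau_1,\tau_2\in(0,1)$,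 $\tau\in(0,1]$, $\delta\in(0,1)$, and $y^0\in\mathrm{Ran}(\mathcal{B})$, for $j=0,1,\dots$: (1) take $\mathcal{U}_j$ as $\mathcal{U}$ with $X=\mathcal{B}^*y^j+G$, set $\mathcal{V}_j:=\mathcal{B}\mathcal{U}_j\mathcal{B}^*$ and $\varepsilon_j=\tau_1\min\{\tau_2,\|\nabla\varphi(y^j)\|\}$, and apply the conjugate gradient method starting from the zero vector to the linear system $(\mathcal{V}_j+\varepsilon_jI_{2n})d+\nabla\varphi(y^j)=0$, obtaining $d^j$ with $\|(\mathcal{V}_j+\varepsilon_jI_{2n})d^j+\nabla\varphi(y^j)\|\le\min(\bar\eta,\|\nabla\varphi(y^j)\|^{1+\tau})$; (2) set $\alpha_j=\delta^{m_j}$ where $m_j$ is the smallest nonnegative integer $m$ with $\varphi(y^j+\delta^md^j)\le\varphi(y^j)+\mu\delta^m\langle\nabla\varphi(y^j),d^j\rangle$; (3) set $y^{j+1}=y^j+\alpha_jd^j$. *)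

(* Defs.v *)
From HB Require Import structures.
From mathcomp Require Import all_boot all_order all_algebra.
From mathcomp Require Import reals exp.
Set Implicit Arguments. Unset Strict Implicit. Unset Printing Implicit Defensive.
Import Order.TTheory GRing.Theory Num.Theory.
Local Open Scope ring_scope.

Section SSNCG.
Variable R : realType.
Variable n : nat.

Definition vec := 'cV[R]_(n + n).
Definition mat := 'M[R]_n.

Definition ones : 'cV[R]_n := const_mx 1.

Definition vdot (u v : vec) : R := \sum_(i < n + n) u i 0 * v i 0.
Definition vnorm (u : vec) : R := Num.sqrt (vdot u u).

Definition mdot (X Y : mat) : R := \sum_(i < n) \sum_(j < n) X i j * Y i j.
Definition mnorm (X : mat) : R := Num.sqrt (mdot X X).

Definition Bop (X : mat) : vec := col_mx (X *m ones) (X^T *m ones).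
Definition Bstar (y : vec) : mat :=
  usubmx y *m ones^T + ones *m (dsubmx y)^T.

Definition RanB (y : vec) : Prop := exists X : mat, y = Bop X.

(* projection onto C = {X >= 0}: entrywise positive part *)
Definition PiC (X : mat) : mat := map_mx (fun x => Num.max x 0) X.

Definition bvec : vec := col_mx ones ones.

Definition phi (G : mat) (y : vec) : R :=
  2^-1 * mnorm (PiC (Bstar y + G)) ^+ 2 - vdot bvec y - 2^-1 * mnorm G ^+ 2.
Definition gradphi (G : mat) (y : vec) : vec := Bop (PiC (Bstar y + G)) - bvec.

Definition Uop (X H : mat) : mat :=
  \matrix_(i, j) (if 0 <= X i j then H i j else 0).

Definition Vop (G : mat) (y : vec) (d : vec) : vec :=
  Bop (Uop (Bstar y + G) (Bstar d)).

(* Conjugate gradient method for A x = rhs started at x_0 = 0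
   (so r_0 = rhs, p_0 = r_0); state (x_k, r_k, p_k). *)
Fixpoint cg_state (A : vec -> vec) (rhs : vec) (k : nat) : vec * vec * vec :=
  match k with
  | 0 => (0, rhs, rhs)
  | k'.+1 =>
    let: (x, r, p) := cg_state A rhs k' in
    let a := vdot r r / vdot p (A p) in
    let x' := x + a *: p in
    let r' := r - a *: A p in
    let b := vdot r' r' / vdot r r in
    (x', r', r' + b *: p)
  end.
Definition cg_iter (A : vec -> vec) (rhs : vec) (k : nat) : vec :=
  (cg_state A rhs k).1.1.

Definition eps_j (tau1 tau2 : R) (G : mat) (y : vec) : R :=
  tau1 * Num.min tau2 (vnorm (gradphi G y)).
Definition Aj (tau1 tau2 : R) (G : mat) (y : vec) (d : vec) : vec :=
  Vop G y d + eps_j tau1 tau2 G y *: d.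

Definition armijo (mu delta : R) (G : mat) (y d : vec) (m : nat) : Prop :=
  phi G (y + delta ^+ m *: d) <= phi G y + mu * delta ^+ m * vdot (gradphi G y) d.

Definition SSNCG1_seq (G : mat) (mu etabar tau1 tau2 tau delta : R)
    (y : nat -> vec) : Prop :=
  RanB (y 0%N) /\
  forall j : nat,
    exists d : vec,
      (exists k : nat,
          d = cg_iter (Aj tau1 tau2 G (y j)) (- gradphi G (y j)) k) /\
      vnorm (Aj tau1 tau2 G (y j) d + gradphi G (y j))
        <= Num.min etabar (powR (vnorm (gradphi G (y j))) (1 + tau)) /\
      exists m : nat,
        armijo mu delta G (y j) d m /\
        (forall m' : nat, (m' < m)%N -> ~ armijo mu delta G (y j) d m') /\
        y j.+1 = y j + delta ^+ m *: d.

Definition optimal (G : mat) (yh : vec) : Prop :=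
  RanB yh /\ forall y : vec, RanB y -> phi G yh <= phi G y.

Definition accum_point (y : nat -> vec) (yh : vec) : Prop :=
  forall e : R, 0 < e -> forall N : nat, exists j : nat, (N <= j)%N /\ vnorm (y j - yh) < e.

End SSNCG.

(* Main.v *)
(** The objective [phi] is convex with a gradient that is Lipschitz of constant
    [L = 2n + 1], and [L] also bounds the spectrum of every regularized Newton
    operator [A].  A conjugate gradient iterate [d] started at zero makes the
    quadratic model [<x, A x>/2 + <grad, x>] at most its value after the first
    step, hence [- <grad, d> >= |grad|^2 / (2 L)] and
    [eps |d|^2 <= - 2 <grad, d>].  With the descent lemma, Armijo backtracking
    then decreases [phi] by a uniform amount as long as [|grad|] stays between
    two positive bounds.  Near a non-stationary accumulation point this would
    happen infinitely often, although [phi] is bounded below along the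
    sequence; so accumulation points are stationary, hence optimal by convexity.
    Boundedness follows from monotonicity of [phi] along the sequence and its
    coercivity on the range of [B]. *)

Require Import Defs.
From HB Require Import structures.
From mathcomp Require Import all_boot all_order all_algebra.
From mathcomp Require Import reals exp.
From mathcomp Require Import ring lra.
Import Order.TTheory GRing.Theory Num.Theory.
Local Open Scope ring_scope.

(** * Euclidean and Frobenius inner products *)

Section InnerProduct.
Context {R : realType} {n : nat}.
Implicit Types (u v w : vec R n) (X Y : mat R n).

Lemma vdotC u v : vdot u v = vdot v u.
Proof. by apply: eq_bigr => i _; rewrite mulrC. Qed.

Lemma vdotDr u v w : vdot u (v + w) = vdot u v + vdot u w.
Proof. by rewrite -big_split; apply: eq_bigr => i _ /=; rewrite !mxE mulrDr. Qed.

Lemma vdotZr a u v : vdot u (a *: v) = a * vdot u v.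
Proof. by rewrite mulr_sumr; apply: eq_bigr => i _; rewrite !mxE mulrCA. Qed.

Lemma vdotNr u v : vdot u (- v) = - vdot u v.
Proof. by rewrite -scaleN1r vdotZr mulN1r. Qed.

Lemma vdotBr u v w : vdot u (v - w) = vdot u v - vdot u w.
Proof. by rewrite vdotDr vdotNr. Qed.

Lemma vdot0r u : vdot u 0 = 0.
Proof. by rewrite -(scale0r (0 : vec R n)) vdotZr mul0r. Qed.

Lemma vdotDl u v w : vdot (u + v) w = vdot u w + vdot v w.
Proof. by rewrite !(vdotC _ w) vdotDr. Qed.

Lemma vdotZl a u v : vdot (a *: u) v = a * vdot u v.
Proof. by rewrite !(vdotC _ v) vdotZr. Qed.

Lemma vdotNl u v : vdot (- u) v = - vdot u v.
Proof. by rewrite !(vdotC _ v) vdotNr. Qed.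

Lemma vdotBl u v w : vdot (u - v) w = vdot u w - vdot v w.
Proof. by rewrite vdotDl vdotNl. Qed.

Lemma vdot_ge0 u : 0 <= vdot u u.
Proof. by apply: sumr_ge0 => i _; rewrite -expr2 sqr_ge0. Qed.

Lemma vdot_eq0 u : (vdot u u == 0) = (u == 0).
Proof.
apply/idP/eqP => [|->]; last by rewrite vdot0r.
rewrite psumr_eq0 => [/allP u0|i _]; last by rewrite -expr2 sqr_ge0.
apply/matrixP => i j; rewrite (ord1 j) mxE.
by have := u0 i (mem_index_enum i); rewrite /= mulf_eq0 orbb => /eqP.
Qed.

Lemma vdot_gt0 u : (0 < vdot u u) = (u != 0).
Proof. by rewrite lt_neqAle vdot_ge0 andbT eq_sym vdot_eq0. Qed.

(** Expand [|e u - v|^2 >= 0] and divide by [e]. This weighted form does the work of Cauchy-Schwarz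
    below. *)
Lemma vdot_young e u v : 0 < e ->
  2 * vdot u v <= e * vdot u u + e^-1 * vdot v v.
Proof.
move=> e0; have := vdot_ge0 (e *: u - v).
rewrite !(vdotBl, vdotBr, vdotZl, vdotZr) (vdotC v u) => h.
have : 0 <= e^-1 * (e * (e * vdot u u) - e * vdot u v - (e * vdot u v - vdot v v)).
  by rewrite mulr_ge0 // ?invr_ge0 ?(ltW e0).
rewrite !mulrBr !(mulrA e^-1 e) mulVf ?gt_eqF // !mul1r; lra.
Qed.

Lemma vdot_sqrD u v : vdot (u + v) (u + v) <= 2 * vdot u u + 2 * vdot v v.
Proof.
have := vdot_ge0 (u - v).
rewrite !(vdotBl, vdotBr, vdotDl, vdotDr) (vdotC v u); lra.
Qed.

(** Apply [|a + b|^2 <= 2|a|^2 + 2|b|^2] to [u = (u - v) + v] and to [v = (v - u) + u]. It will keep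
    gradients near a nonzero one between two positive bounds. *)
Lemma vdot_near u v : vdot (u - v) (u - v) < vdot v v / 4 ->
  vdot v v / 4 <= vdot u u <= 4 * vdot v v.
Proof.
have := vdot_sqrD (u - v) v; have := vdot_sqrD (v - u) u.
have -> : vdot (v - u) (v - u) = vdot (u - v) (u - v).
  by rewrite -[v - u]opprB vdotNl vdotNr opprK.
rewrite !subrK => h1 h2 h3; apply/andP; split; lra.
Qed.

Lemma vdot_split u v :
  vdot u v = \sum_(i < n) u (lshift n i) 0 * v (lshift n i) 0
           + \sum_(i < n) u (rshift n i) 0 * v (rshift n i) 0.
Proof. by rewrite /vdot big_split_ord. Qed.

Lemma mdot_ge0 X : 0 <= mdot X X.
Proof.
by apply: sumr_ge0 => i _; apply: sumr_ge0 => j _; rewrite -expr2 sqr_ge0.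
Qed.

Lemma mnorm_sqr X : mnorm X ^+ 2 = mdot X X.
Proof. by rewrite sqr_sqrtr // mdot_ge0. Qed.

Lemma mdot_young e X Y : 0 < e ->
  2 * mdot X Y <= e * mdot X X + e^-1 * mdot Y Y.
Proof.
move=> e0; rewrite !mulr_sumr -big_split; apply: ler_sum => i _ /=.
rewrite !mulr_sumr -big_split; apply: ler_sum => j _ /=.
have : 0 <= e^-1 * (e * X i j - Y i j) ^+ 2.
  by rewrite mulr_ge0 ?invr_ge0 ?(ltW e0) ?sqr_ge0.
rewrite sqrrB !mulrDr mulrN; set a := X i j; set b := Y i j.
have -> : e^-1 * (e * a) ^+ 2 = e * (a * a) by field; rewrite gt_eqF.
have -> : e^-1 * (e * a * b *+ 2) = 2 * (a * b) by field; rewrite gt_eqF.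
rewrite expr2; lra.
Qed.

End InnerProduct.

(** The summand [2n] bounds the squared norm of [Bstar]; the added 1 absorbs the regularization
    [eps <= 1] and keeps the constant positive when [n = 0]. *)
Definition Lip (R : realType) (n : nat) : R := (n + n)%:R + 1.

Lemma Lip_gt0 R n : 0 < Lip R n.
Proof. by rewrite /Lip ltr_wpDl. Qed.

(** * The operator [Bop], its adjoint and its range *)

Section Operators.
Context {R : realType} {n : nat}.
Implicit Types (u v w y : vec R n) (X Y G : mat R n).

Lemma Bstar_mxE y i j : Bstar y i j = y (lshift n i) 0 + y (rshift n j) 0.
Proof. by rewrite !mxE !big_ord1 !mxE mulr1 mul1r. Qed.

Lemma Bop_lshift X i : Bop X (lshift n i) 0 = \sum_j X i j.
Proof. by rewrite col_mxEu mxE; apply: eq_bigr => j _; rewrite mxE mulr1. Qed.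

Lemma Bop_rshift X j : Bop X (rshift n j) 0 = \sum_i X i j.
Proof. by rewrite col_mxEd mxE; apply: eq_bigr => i _; rewrite !mxE mulr1. Qed.

Lemma vdot_Bop X y : vdot (Bop X) y = mdot X (Bstar y).
Proof.
rewrite vdot_split.
under eq_bigr do rewrite Bop_lshift mulr_suml.
under [X in _ + X]eq_bigr do rewrite Bop_rshift mulr_suml.
rewrite [X in _ + X]exchange_big /= -big_split; apply: eq_bigr => i _ /=.
by rewrite -big_split; apply: eq_bigr => j _; rewrite /= Bstar_mxE mulrDr.
Qed.

Lemma BopD X Y : Bop (X + Y) = Bop X + Bop Y.
Proof. by rewrite /Bop linearD !mulmxDl add_col_mx. Qed.

Lemma BopZ a X : Bop (a *: X) = a *: Bop X.
Proof. by rewrite /Bop linearZ -!scalemxAl scale_col_mx. Qed.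

Lemma BopB X Y : Bop (X - Y) = Bop X - Bop Y.
Proof. by rewrite BopD -scaleN1r BopZ scaleN1r. Qed.

Lemma BstarD u v : Bstar (u + v) = Bstar u + Bstar v.
Proof. apply/matrixP => i j; rewrite [RHS]mxE !Bstar_mxE !mxE; ring. Qed.

Lemma BstarZ a v : Bstar (a *: v) = a *: Bstar v.
Proof. apply/matrixP => i j; rewrite [RHS]mxE !Bstar_mxE !mxE; ring. Qed.

Lemma mdot_Bstar y : mdot (Bstar y) (Bstar y) <= (n + n)%:R * vdot y y.
Proof.
pose a i := y (lshift n i) 0; pose b i := y (rshift n i) 0.
apply: le_trans (_ : \sum_(i < n) \sum_(j < n)
   (2 * (a i * a i) + 2 * (b j * b j)) <= _).
  apply: ler_sum => i _; apply: ler_sum => j _.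
  rewrite Bstar_mxE -/(a i) -/(b j); have := sqr_ge0 (a i - b j).
  rewrite expr2; lra.
under eq_bigr do
  rewrite big_split sumr_const card_ord -mulr_sumr -[_ *+ n]mulr_natr.
rewrite big_split /= -mulr_suml -mulr_sumr sumr_const card_ord.
rewrite -[_ *+ n]mulr_natr vdot_split natrD /a /b.
by rewrite le_eqVlt; apply/orP; left; apply/eqP; ring.
Qed.

Lemma mdot_Bstar_Lip y : mdot (Bstar y) (Bstar y) <= Lip R n * vdot y y.
Proof.
apply: le_trans (mdot_Bstar y) _; rewrite mulrDl mul1r lerDl; exact: vdot_ge0.
Qed.

(** Duality: Young's inequality with weight [L] on [<X, B^* B X> = |B X|^2] leaves
    [|B^* B X|^2 / L], which the bound on [Bstar] absorbs into [|B X|^2]. *)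
Lemma vdot_Bop_Lip X : vdot (Bop X) (Bop X) <= Lip R n * mdot X X.
Proof.
have := mdot_young _ X (Bstar (Bop X)) (Lip_gt0 R n).
rewrite -vdot_Bop => h.
have : (Lip R n)^-1 * mdot (Bstar (Bop X)) (Bstar (Bop X)) <= vdot (Bop X) (Bop X).
  by rewrite mulrC ler_pdivrMr ?Lip_gt0 // mulrC mdot_Bstar_Lip.
lra.
Qed.

Lemma RanB_Bop X : RanB (Bop X).
Proof. by exists X. Qed.

Lemma RanBD u v : RanB u -> RanB v -> RanB (u + v).
Proof. by move=> [X ->] [Y ->]; exists (X + Y); rewrite BopD. Qed.

Lemma RanBZ a u : RanB u -> RanB (a *: u).
Proof. by move=> [X ->]; exists (a *: X); rewrite BopZ. Qed.

Lemma RanBB u v : RanB u -> RanB v -> RanB (u - v).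
Proof. by move=> hu hv; apply: RanBD hu _; rewrite -scaleN1r; apply: RanBZ. Qed.

Lemma RanB_bvec : RanB (bvec R n).
Proof. by exists 1%:M; rewrite /Bop trmx1 !mul1mx. Qed.

Lemma RanB_gradphi G y : RanB (gradphi G y).
Proof. by apply: RanBB; [apply: RanB_Bop|apply: RanB_bvec]. Qed.

(* [(e, -e)] spans the kernel of [Bstar], the orthogonal complement of [RanB]. *)
Definition kervec : vec R n := col_mx (@ones R n) (- @ones R n).

Lemma vdot_kervec y :
  vdot kervec y = \sum_i y (lshift n i) 0 - \sum_i y (rshift n i) 0.
Proof.
rewrite vdot_split -sumrN; congr (_ + _); apply: eq_bigr => i _.
  by rewrite col_mxEu mxE mul1r.
by rewrite col_mxEd !mxE mulN1r.
Qed.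

(** Row sums and column sums of a matrix have the same total, and this one linear equation cuts out
    the range. It serves both closedness of the range and coercivity on it. *)
Lemma RanBP y : RanB y <-> vdot kervec y = 0.
Proof.
split=> [[X ->]|].
  rewrite vdot_kervec; apply/eqP; rewrite subr_eq0; apply/eqP.
  under eq_bigr do rewrite Bop_lshift.
  by under [RHS]eq_bigr do rewrite Bop_rshift; rewrite exchange_big.
rewrite vdot_kervec => /eqP; rewrite subr_eq0 => /eqP s_eq.
case: (posnP n) => [n0|n_gt0].
  exists 0; apply/matrixP => i j; suff: (i < 0)%N by [].
  by apply: leq_trans (ltn_ord i) _; rewrite n0.
pose s := \sum_i y (lshift n i) 0.
have nz : n%:R != 0 :> R by rewrite pnatr_eq0 -lt0n.
(* The entries are [(y1_i + y2_j - s/n) / n]: in each row or column sum the shift cancels the total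
   [s] of the other half. *)
exists (n%:R^-1 *: (Bstar y - const_mx (n%:R^-1 * s))).
apply/matrixP => k j; rewrite (ord1 j) => {j}.
case: (split_ordP k) => i ->.
  rewrite Bop_lshift; under eq_bigr do rewrite mxE mxE Bstar_mxE !mxE.
  rewrite -mulr_sumr big_split big_split /= -s_eq -/s !sumr_const card_ord.
  rewrite -[_ *+ n]mulr_natr -[(- _) *+ n]mulr_natr; by field.
rewrite Bop_rshift; under eq_bigr do rewrite mxE mxE Bstar_mxE !mxE.
rewrite -mulr_sumr big_split big_split /= -/s !sumr_const card_ord.
rewrite -[_ *+ n]mulr_natr -[(- _) *+ n]mulr_natr; by field.
Qed.

End Operators.

(** * Scalar inequalities for the positive part and its square *)

Section PositivePart.
Context {R : realType}.
Implicit Types z w : R.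

Lemma half_sqr_max_ge z w :
  2^-1 * Num.max z 0 ^+ 2 + Num.max z 0 * w <= 2^-1 * Num.max (z + w) 0 ^+ 2.
Proof. by case: (leP z 0); case: (leP (z + w) 0) => *; nra. Qed.

Lemma half_sqr_max_le z w :
  2^-1 * Num.max (z + w) 0 ^+ 2
    <= 2^-1 * Num.max z 0 ^+ 2 + Num.max z 0 * w + 2^-1 * w ^+ 2.
Proof.
have h0 := sqr_ge0 w; have h1 := sqr_ge0 (z + w).
case: (leP z 0) => hz; case: (leP (z + w) 0) => hw; [nra| |nra|nra].
have : 0 <= - z * (w + (z + w)) by apply: mulr_ge0; lra.
nra.
Qed.

Lemma max0_sqr_dist z w :
  (Num.max z 0 - Num.max w 0) ^+ 2 <= (z - w) ^+ 2.
Proof.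
have h0 := sqr_ge0 (z - w).
case: (leP z 0) => hz; case: (leP w 0) => hw; [nra| | |nra].
- have : 0 <= - z * (w + (w - z)) by apply: mulr_ge0; lra.
  nra.
- have : 0 <= - w * (z + (z - w)) by apply: mulr_ge0; lra.
  nra.
Qed.

(** For [z <= 0] the term [- t z] already equals [t |z|]; for [z > 0] the gap is
    [(z - 2t)^2 / 2]. *)
Lemma half_sqr_max_coercive (t z : R) : 0 <= t ->
  t * `|z| - 2 * t ^+ 2 <= 2^-1 * Num.max z 0 ^+ 2 - t * z.
Proof.
move=> t0; case: (leP z 0) => z0.
  by rewrite ler0_norm //; nra.
rewrite gtr0_norm //; have := sqr_ge0 (z - 2 * t); rewrite sqrrB; nra.
Qed.

End PositivePart.

(** * Convexity, smoothness and coercivity of the objective *)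

Section Objective.
Context {R : realType} {n : nat}.
Implicit Types (G : mat R n) (y d : vec R n).

Lemma phi_sum G y : phi G y =
  \sum_i \sum_j 2^-1 * Num.max ((Bstar y + G) i j) 0 ^+ 2
  - vdot (bvec R n) y - 2^-1 * mnorm G ^+ 2.
Proof.
rewrite /phi mnorm_sqr; congr (_ - _ - _).
rewrite mulr_sumr; apply: eq_bigr => i _; rewrite mulr_sumr.
by apply: eq_bigr => j _; rewrite !mxE expr2.
Qed.

Lemma vdot_gradphi G y d : vdot (gradphi G y) d =
  \sum_i \sum_j Num.max ((Bstar y + G) i j) 0 * Bstar d i j
  - vdot (bvec R n) d.
Proof.
rewrite vdotBl vdot_Bop; congr (_ - _).
by apply: eq_bigr => i _; apply: eq_bigr => j _; rewrite [PiC _ _ _]mxE.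
Qed.

Lemma BstarDG G y d i j :
  (Bstar (y + d) + G) i j = (Bstar y + G) i j + Bstar d i j.
Proof. by rewrite BstarD addrAC mxE. Qed.

Lemma phi_convex G y d : phi G y + vdot (gradphi G y) d <= phi G (y + d).
Proof.
rewrite !phi_sum vdot_gradphi vdotDr.
suff : \sum_i \sum_j 2^-1 * Num.max ((Bstar y + G) i j) 0 ^+ 2
   + \sum_i \sum_j Num.max ((Bstar y + G) i j) 0 * Bstar d i j
   <= \sum_i \sum_j 2^-1 * Num.max ((Bstar (y + d) + G) i j) 0 ^+ 2 by lra.
rewrite -big_split; apply: ler_sum => i _.
rewrite -big_split; apply: ler_sum => j _.
by rewrite BstarDG half_sqr_max_ge.
Qed.

Lemma phi_descent G y d :
  phi G (y + d) <= phi G y + vdot (gradphi G y) d + 2^-1 * Lip R n * vdot d d.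
Proof.
rewrite !phi_sum vdot_gradphi vdotDr; have := mdot_Bstar_Lip d.
suff : \sum_i \sum_j 2^-1 * Num.max ((Bstar (y + d) + G) i j) 0 ^+ 2
   <= \sum_i \sum_j 2^-1 * Num.max ((Bstar y + G) i j) 0 ^+ 2
   + \sum_i \sum_j Num.max ((Bstar y + G) i j) 0 * Bstar d i j
   + 2^-1 * mdot (Bstar d) (Bstar d) by lra.
rewrite mulr_sumr -!big_split; apply: ler_sum => i _ /=.
rewrite mulr_sumr -!big_split; apply: ler_sum => j _ /=.
by rewrite BstarDG -expr2 half_sqr_max_le.
Qed.

(** Up to shifts the gradient composes [Bstar], the nonexpansive [PiC] and [Bop]; each linear map
    contributes one factor [L] to the squared bound. *)
Lemma gradphi_Lipschitz G y z :
  vdot (gradphi G y - gradphi G z) (gradphi G y - gradphi G z)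
    <= Lip R n ^+ 2 * vdot (y - z) (y - z).
Proof.
have -> : gradphi G y - gradphi G z = Bop (PiC (Bstar y + G) - PiC (Bstar z + G)).
  by rewrite BopB /gradphi opprB addrA subrK.
apply: le_trans (vdot_Bop_Lip _) _.
rewrite expr2 -mulrA ler_pM2l ?Lip_gt0 //; apply: le_trans (mdot_Bstar_Lip _).
apply: ler_sum => i _; apply: ler_sum => j _.
have -> : Bstar (y - z) i j = (Bstar y + G) i j - (Bstar z + G) i j.
  by rewrite -[in RHS](subrK z y) (addrC (y - z)) BstarDG addrC addKr.
by rewrite -!expr2 !mxE max0_sqr_dist.
Qed.

Lemma gradphi_eq0_optimal G y : RanB y -> gradphi G y = 0 -> optimal G y.
Proof.
move=> hy g0; split=> // z _; have := phi_convex G y (z - y).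
by rewrite g0 vdotC vdot0r addr0 addrC subrK.
Qed.

(** Expanding the squares leaves the cross term [2 (sum y1) (sum y2)], which on the range is twice a
    square. *)
Lemma Bstar_RanB_ge y : RanB y ->
  n%:R * vdot y y <= mdot (Bstar y) (Bstar y).
Proof.
move/RanBP; rewrite vdot_kervec => /eqP; rewrite subr_eq0 => /eqP s_eq.
rewrite [mdot _ _](_ : _ = \sum_(i < n) \sum_(j < n)
   (y (lshift n i) 0 * y (lshift n i) 0 + y (rshift n j) 0 * y (rshift n j) 0
    + 2 * (y (lshift n i) 0 * y (rshift n j) 0))); last first.
  by apply: eq_bigr => i _; apply: eq_bigr => j _; rewrite Bstar_mxE; ring.
under eq_bigr do rewrite !big_split -!mulr_sumr sumr_const card_ord mulrnAr.
rewrite !big_split /= sumrMnl -!mulr_sumr -mulr_suml -s_eq sumr_const card_ord.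
rewrite -!(mulr_natl (\sum_(i < n) _)) vdot_split.
have := sqr_ge0 (\sum_i y (lshift n i) 0); rewrite expr2; lra.
Qed.

(* The strictly positive matrix [ee^T/n] is mapped to [b] by [B], so that
   [<b, y>] is the sum of the entries of [B^* y] over [n] and [phi] separates
   into coercive functions of the entries of [B^* y + G]. *)
Lemma phi_sublevel_bounded G (c : R) :
  exists M, forall y, RanB y -> phi G y <= c -> vnorm y <= M.
Proof.
have [n0|n_gt0] := posnP n.
  exists 0 => y _ _; rewrite /vnorm /vdot big1 ?sqrtr0 // => i _.
  suff: (i < 0)%N by [].
  by apply: leq_trans (ltn_ord i) _; rewrite n0.
pose t : R := n%:R^-1; have t_gt0 : 0 < t by rewrite invr_gt0 ltr0n.
have nz : n%:R != 0 :> R by rewrite pnatr_eq0 -lt0n.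
have bE : bvec R n = Bop (const_mx t).
  apply/matrixP => k j; rewrite (ord1 j).
  have tn : t *+ n = 1 by rewrite -mulr_natr mulVf.
  case: (split_ordP k) => i ->.
    rewrite Bop_lshift col_mxEu mxE; under eq_bigr do rewrite mxE.
    by rewrite sumr_const card_ord tn.
  rewrite Bop_rshift col_mxEd mxE; under eq_bigr do rewrite mxE.
  by rewrite sumr_const card_ord tn.
(* [K] collects the constants of [phi] and the loss [2 t^2] per entry, so that [phi G y <= c] bounds
   the weighted l1 norm of [Bstar y + G] by [K]. *)
pose K := c + 2^-1 * mnorm G ^+ 2 - \sum_i \sum_j t * G i j
  + \sum_(i < n) \sum_(j < n) 2 * t ^+ 2.
exists (Num.sqrt (\sum_i \sum_j (t^-1 * K + `|G i j|) ^+ 2)) => y Ry phi_le.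
have sum_le : \sum_i \sum_j t * `|(Bstar y + G) i j| <= K.
  have : \sum_i \sum_j (t * `|(Bstar y + G) i j| - 2 * t ^+ 2) <=
      \sum_i \sum_j (2^-1 * Num.max ((Bstar y + G) i j) 0 ^+ 2
         - t * (Bstar y + G) i j).
    apply: ler_sum => i _; apply: ler_sum => j _.
    exact/half_sqr_max_coercive/ltW.
  under eq_bigr do rewrite sumrB.
  under [X in _ <= X]eq_bigr do rewrite sumrB.
  rewrite !sumrB.
  have : vdot (bvec R n) y = \sum_i \sum_j t * (Bstar y + G) i j
      - \sum_i \sum_j t * G i j.
    rewrite bE vdot_Bop -sumrB; apply: eq_bigr => i _; rewrite -sumrB.
    apply: eq_bigr => j _; rewrite [const_mx _ _ _]mxE [(_ + G) i j]mxE; ring.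
  by move: phi_le; rewrite phi_sum /K; lra.
have entry_le i j : `|(Bstar y + G) i j| <= t^-1 * K.
  rewrite ler_pdivlMl //; apply: le_trans sum_le.
  have nonneg i' j' : 0 <= t * `|(Bstar y + G) i' j'|.
    by rewrite mulr_ge0 ?normr_ge0 // ltW.
  rewrite (bigD1 i) //=; apply: ler_wpDr.
    by apply: sumr_ge0 => i' _; apply: sumr_ge0.
  by rewrite (bigD1 j) //=; apply: ler_wpDr; rewrite ?sumr_ge0.
rewrite ler_wsqrtr //; apply: le_trans (_ : mdot (Bstar y) (Bstar y) <= _).
  apply: le_trans (Bstar_RanB_ge y Ry).
  by rewrite ler_peMl ?vdot_ge0 // ler1n.
apply: ler_sum => i _; apply: ler_sum => j _.
rewrite -expr2 -real_normK ?num_real //.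
rewrite ler_pXn2r ?nnegrE ?normr_ge0 ?addr_ge0 ?(le_trans _ (entry_le i j)) //.
have -> : Bstar y i j = (Bstar y + G) i j - G i j by rewrite [(_ + G) i j]mxE addrK.
by apply: le_trans (ler_normB _ _) _; rewrite lerD2r.
Qed.

End Objective.

(** * Linearity, symmetry and spectral bounds of the regularized Newton operator *)

Section NewtonOperator.
Context {R : realType} {n : nat}.
Variables (G : mat R n) (y : vec R n) (tau1 tau2 : R).
Implicit Types (u v d : vec R n).

Local Notation A := (Aj tau1 tau2 G y).
Local Notation eps := (eps_j tau1 tau2 G y).

(** The 0-1 mask and [eps] are frozen at [y], independently of the direction. *)
Lemma AjDZ u v (a : R) : A (u + a *: v) = A u + a *: A v.
Proof.
rewrite /Aj !scalerDr !scalerA (mulrC a) addrACA; congr (_ + _).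
rewrite /Vop -BopZ -BopD BstarD BstarZ.
congr Bop; apply/matrixP => i j; rewrite [LHS]mxE [RHS]mxE.
rewrite [X in _ = _ + X]mxE ![Uop _ _ _ _]mxE.
by case: (_ <= _); rewrite ?mulr0 ?addr0 // !mxE.
Qed.

Lemma vdot_Vop u v : vdot (Vop G y u) v =
  \sum_i \sum_j (if 0 <= (Bstar y + G) i j then Bstar u i j * Bstar v i j else 0).
Proof.
rewrite vdot_Bop; apply: eq_bigr => i _; apply: eq_bigr => j _.
by rewrite [Uop _ _ _ _]mxE; case: ifP => // _; rewrite mul0r.
Qed.

Lemma Aj_sym u v : vdot u (A v) = vdot v (A u).
Proof.
rewrite /Aj 2!vdotDr 2!vdotZr (vdotC v u); congr (_ + _).
rewrite vdotC [RHS]vdotC !vdot_Vop; apply: eq_bigr => i _.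
by apply: eq_bigr => j _; rewrite mulrC.
Qed.

Lemma Aj_ge v : eps * vdot v v <= vdot v (A v).
Proof.
rewrite vdotDr vdotZr lerDr vdotC vdot_Vop.
apply: sumr_ge0 => i _; apply: sumr_ge0 => j _.
by case: ifP => // _; rewrite -expr2 sqr_ge0.
Qed.

(** Masking only discards squares from [|Bstar v|^2 <= 2n |v|^2], and [eps] adds at most 1. *)
Lemma Aj_le v : eps <= 1 -> vdot v (A v) <= Lip R n * vdot v v.
Proof.
move=> e1; rewrite vdotDr vdotZr mulrDl; apply: lerD; last first.
  by rewrite ler_wpM2r ?vdot_ge0.
apply: le_trans (mdot_Bstar v); rewrite vdotC vdot_Vop.
apply: ler_sum => i _; apply: ler_sum => j _.
by case: ifP => // _; rewrite -expr2 sqr_ge0.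
Qed.

Lemma RanB_Aj u : RanB u -> RanB (A u).
Proof. by move=> hu; apply: RanBD; [apply: RanB_Bop|apply: RanBZ]. Qed.

End NewtonOperator.

(** * Conjugate gradient iterates and the quadratic model *)

Section ConjugateGradient.
Context {R : realType} {n : nat}.
Variables (A : vec R n -> vec R n) (rhs : vec R n).

Lemma RanB_cg_iter k : (forall u, RanB u -> RanB (A u)) -> RanB rhs ->
  RanB (cg_iter A rhs k).
Proof.
move=> RA Rrhs; rewrite /cg_iter.
suff : [/\ RanB (cg_state A rhs k).1.1, RanB (cg_state A rhs k).1.2
       & RanB (cg_state A rhs k).2] by case.
elim: k => [|k] /=.
  by split=> //; rewrite -(scale0r rhs); apply: RanBZ.
case: (cg_state A rhs k) => [[x r] p] /= [Rx Rr Rp].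
have Rr' : RanB (r - (vdot r r / vdot p (A p)) *: A p).
  by apply: RanBB => //; apply/RanBZ/RA.
by split=> //; apply: RanBD => //; apply: RanBZ.
Qed.

Hypothesis A_lin : forall u v (a : R), A (u + a *: v) = A u + a *: A v.
Hypothesis A_sym : forall u v, vdot u (A v) = vdot v (A u).
Hypothesis A_pd : forall v, v != 0 -> 0 < vdot v (A v).

Definition quad_model (x : vec R n) : R := 2^-1 * vdot x (A x) - vdot rhs x.

(* Each CG step is an exact line search for the quadratic model; the local
   relations [r = rhs - A x] and [<r, p> = <r, r>] already make it decrease, so
   neither the global orthogonality of the residuals nor the conjugacy of the
   directions is needed. *)
Lemma cg_state_invariant k (x := (cg_state A rhs k).1.1)
    (r := (cg_state A rhs k).1.2) (p := (cg_state A rhs k).2) :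
  [/\ r = rhs - A x, vdot r p = vdot r r, quad_model x <= 0
    & (0 < k)%N ->
      quad_model x <= - (2^-1 * (vdot rhs rhs ^+ 2 / vdot rhs (A rhs)))].
Proof.
have A0 : A 0 = 0.
  by have := A_lin 0 0 (-1); rewrite scaler0 addr0 scaleN1r subrr.
rewrite {}/x {}/r {}/p; elim: k => [|k] /=.
  by split=> //; rewrite ?A0 ?subr0 // /quad_model A0 !vdot0r mulr0 subr0.
case Ek: (cg_state A rhs k) => [[x r] p] /= [rE rp q0 qk].
set a := vdot r r / vdot p (A p).
(* If [p = 0] then [<r, r> = <r, p> = 0], so the identity survives the zero denominator. *)
have paAp : a * vdot p (A p) = vdot r r.
  have [p0|p0] := eqVneq p 0; last by rewrite divfK // gt_eqF // A_pd.
  by rewrite p0 A0 vdot0r mulr0 -rp p0 vdot0r.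
have qE : quad_model (x + a *: p)
    = quad_model x - 2^-1 * (vdot r r ^+ 2 / vdot p (A p)).
  have -> : vdot r r ^+ 2 / vdot p (A p) = a * vdot r r by rewrite /a; ring.
  have : vdot r p = vdot rhs p - vdot p (A x) by rewrite rE vdotBl (vdotC (A x)).
  rewrite rp => rr; have := mulrBr a (vdot rhs p) (vdot p (A x)).
  rewrite -rr /quad_model A_lin !(vdotDl, vdotDr, vdotZl, vdotZr).
  rewrite (A_sym x p) paAp; lra.
have dec : 0 <= 2^-1 * (vdot r r ^+ 2 / vdot p (A p)).
  rewrite mulr_ge0 ?invr_ge0 // mulr_ge0 ?sqr_ge0 // invr_ge0.
  by have [->|/A_pd/ltW//] := eqVneq p 0; rewrite A0 vdot0r.
split.
- by rewrite A_lin rE opprD addrA.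
- rewrite vdotDr vdotZr [vdot (r - a *: A p) p]vdotBl vdotZl (vdotC (A p)).
  by rewrite paAp rp subrr mulr0 addr0.
- rewrite qE; lra.
(* The first step starts from [x = 0] and [r = p = rhs], so its drop is exactly the claimed one;
   later steps only lower the model. *)
- move=> _; rewrite qE; case: k Ek qk => [|k] Ek qk.
    by case: Ek => <- <- <-; rewrite /quad_model A0 !vdot0r mulr0 subr0 add0r.
  have := qk isT; lra.
Qed.

Lemma cg_iter_curvature k :
  vdot (cg_iter A rhs k) (A (cg_iter A rhs k)) <= 2 * vdot rhs (cg_iter A rhs k).
Proof.
case: (cg_state_invariant k) => _ _; rewrite -/(cg_iter A rhs k) /quad_model; lra.
Qed.

Lemma cg_iter_descent k : (0 < k)%N ->
  2^-1 * (vdot rhs rhs ^+ 2 / vdot rhs (A rhs)) <= vdot rhs (cg_iter A rhs k).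
Proof.
case: (cg_state_invariant k) => _ _ _; rewrite -/(cg_iter A rhs k) => h /h.
rewrite /quad_model; set x := cg_iter _ _ _.
suff : 0 <= vdot x (A x) by lra.
have [x0|/A_pd/ltW//] := eqVneq x 0.
by rewrite x0 vdotC vdot0r.
Qed.

End ConjugateGradient.

(** * Uniform decrease of the objective under Armijo backtracking *)

Section Decrease.
Context {R : realType} {n : nat}.
Variables (G : mat R n) (mu tau1 tau2 delta : R).
Hypotheses (hmu : 0 < mu < 2^-1) (htau1 : 0 < tau1 < 1) (htau2 : 0 < tau2 < 1)
  (hdelta : 0 < delta < 1).
Implicit Type y : vec R n.

Local Notation newton_dir y k :=
  (cg_iter (Aj tau1 tau2 G y) (- gradphi G y) k).

Lemma eps_j_gt0 y : gradphi G y != 0 -> 0 < eps_j tau1 tau2 G y.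
Proof.
move=> g0; have /andP[t1 _] := htau1; have /andP[t2 _] := htau2.
by rewrite mulr_gt0 // lt_min t2 sqrtr_gt0 vdot_gt0.
Qed.

Lemma eps_j_le1 y : eps_j tau1 tau2 G y <= 1.
Proof.
have /andP[t1 t1'] := htau1; have /andP[t2 t2'] := htau2.
have : Num.min tau2 (vnorm (gradphi G y)) <= tau2 by rewrite ge_min lexx.
by rewrite /eps_j => ?; nra.
Qed.

Lemma Aj_pd y v : gradphi G y != 0 -> v != 0 -> 0 < vdot v (Aj tau1 tau2 G y v).
Proof.
move=> g0 v0; apply: lt_le_trans (Aj_ge _ _ _ _ _).
by rewrite mulr_gt0 ?vdot_gt0 // eps_j_gt0.
Qed.

Lemma newton_dir_curvature y k : gradphi G y != 0 ->
  eps_j tau1 tau2 G y * vdot (newton_dir y k) (newton_dir y k)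
    <= - (2 * vdot (gradphi G y) (newton_dir y k)).
Proof.
move=> g0; apply: le_trans (Aj_ge _ _ _ _ _) _.
apply: le_trans (cg_iter_curvature _ _ _ _ _ _) _.
- exact: AjDZ.
- exact: Aj_sym.
- by move=> v v0; exact: (Aj_pd y v g0 v0).
- by rewrite vdotNl mulrN.
Qed.

Lemma newton_dir_nonascent y k : vdot (gradphi G y) (newton_dir y k) <= 0.
Proof.
have [->|g0] := eqVneq (gradphi G y) 0; first by rewrite vdotC vdot0r.
have := newton_dir_curvature y k g0.
suff : 0 <= eps_j tau1 tau2 G y * vdot (newton_dir y k) (newton_dir y k) by lra.
by rewrite mulr_ge0 ?vdot_ge0 // ltW // eps_j_gt0.
Qed.

Lemma newton_dir_descent y k : (0 < k)%N -> gradphi G y != 0 ->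
  2^-1 * ((Lip R n)^-1 * vdot (gradphi G y) (gradphi G y))
    <= - vdot (gradphi G y) (newton_dir y k).
Proof.
move=> k0 g0; set g := gradphi G y; rewrite -vdotNl.
have Ng : vdot (- g) (- g) = vdot g g by rewrite vdotNl vdotNr opprK.
apply: le_trans (cg_iter_descent _ _ _ _ _ _ k0).
- rewrite ler_pM2l ?invr_gt0 // Ng.
  have Ng0 : - g != 0 by rewrite oppr_eq0.
  rewrite ler_pdivlMr ?Aj_pd // -mulrA ler_pdivrMl ?Lip_gt0 //.
  rewrite expr2 [X in _ <= X]mulrCA ler_wpM2l ?vdot_ge0 //.
  by rewrite -Ng; apply: Aj_le; apply: eps_j_le1.
- exact: AjDZ.
- exact: Aj_sym.
- by move=> v v0; exact: (Aj_pd y v g0 v0).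
Qed.

(** A lower bound on the gradient gives [eps >= e > 0], hence [e |d|^2 <= - 2 <g, d>]; Young's
    inequality with weight [2/e] absorbs half of the left side. *)
Lemma newton_dir_bounded (ga Ga : R) : 0 < ga ->
  exists2 D, 0 < D & forall y k,
    ga <= vdot (gradphi G y) (gradphi G y) <= Ga ->
    vdot (newton_dir y k) (newton_dir y k) <= D.
Proof.
move=> ga0; have /andP[t1 _] := htau1; have /andP[t2 _] := htau2.
pose e := tau1 * Num.min tau2 (Num.sqrt ga).
have e0 : 0 < e by rewrite mulr_gt0 // lt_min t2 sqrtr_gt0.
(* The sign of [Ga] is unspecified, hence [|Ga|]; the added 1 makes the bound positive. *)
exists (2 / e * (2 / e) * `|Ga| + 1).
  by rewrite ltr_wpDl // mulr_ge0 // -expr2 sqr_ge0.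
move=> y k /andP[g_ge g_le]; set d := newton_dir y k.
have g0 : gradphi G y != 0 by rewrite -vdot_gt0 (lt_le_trans ga0).
have le_e : e <= eps_j tau1 tau2 G y.
  by rewrite ler_pM2l // le_min2 // ler_wsqrtr.
have h1 := newton_dir_curvature y k g0; rewrite -/d in h1.
have h2 : e * vdot d d <= eps_j tau1 tau2 G y * vdot d d.
  by rewrite ler_wpM2r ?vdot_ge0.
have e2 : 0 < 2 / e by rewrite divr_gt0.
have := vdot_young _ (- gradphi G y) d e2.
rewrite !vdotNl vdotNr opprK invf_div => h3.
have h4 : 2 / e * vdot (gradphi G y) (gradphi G y) <= 2 / e * `|Ga|.
  by rewrite ler_pM2l // (le_trans g_le) // ler_norm.
have h5 : e / 2 * vdot d d <= 2 / e * `|Ga| by lra.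
apply: le_trans (_ : 2 / e * (2 / e * `|Ga|) <= _); last by rewrite -mulrA; lra.
by rewrite -ler_pdivrMl // invf_div.
Qed.

(** Either [m = 0], or the step [t = delta^(m-1)] failed the Armijo test; the descent lemma then
    forces [t L |d|^2 > 2 (1 - mu) s], and [1 - mu > 1/2]. *)
Lemma armijo_step_ge y d (m : nat) (s D : R) :
  0 < s -> 0 < D -> s <= - vdot (gradphi G y) d -> vdot d d <= D ->
  (forall m', (m' < m)%N -> ~ armijo mu delta G y d m') ->
  Num.min 1 (delta * (s / (Lip R n * D))) <= delta ^+ m.
Proof.
move=> s0 D0 s_le d_le; have /andP[d0 d1] := hdelta; have /andP[mu0 mu1] := hmu.
case: m => [_|m /(_ m (ltnSn m)) /negP]; first by rewrite expr0 ge_min lexx.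
rewrite -ltNge => fail; rewrite ge_min; apply/orP; right.
set t := delta ^+ m in fail; have t0 : 0 < t by rewrite exprn_gt0.
rewrite exprS ler_pM2l // -/t ler_pdivrMr ?mulr_gt0 ?Lip_gt0 //.
have := lt_le_trans fail (phi_descent _ _ _).
rewrite !vdotZr vdotZl => h; have L0 := Lip_gt0 R n.
have h' : t * ((1 - mu) * - vdot (gradphi G y) d)
    < t * (2^-1 * (t * (Lip R n * vdot d d))) by lra.
rewrite ltr_pM2l // in h'.
have hd : t * (Lip R n * vdot d d) <= t * (Lip R n * D).
  by rewrite !ler_pM2l.
have : 2^-1 * s <= (1 - mu) * - vdot (gradphi G y) d by nra.
lra.
Qed.

Lemma uniform_decrease (ga Ga : R) : 0 < ga ->
  exists2 c, 0 < c & forall y k m,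
    ga <= vdot (gradphi G y) (gradphi G y) <= Ga -> (0 < k)%N ->
    armijo mu delta G y (newton_dir y k) m ->
    (forall m', (m' < m)%N -> ~ armijo mu delta G y (newton_dir y k) m') ->
    phi G (y + delta ^+ m *: newton_dir y k) <= phi G y - c.
Proof.
move=> ga0; have [D D0 hD] := newton_dir_bounded ga Ga ga0.
have /andP[d0 d1] := hdelta; have /andP[mu0 mu1] := hmu.
(* [s] bounds [- <g, d>] from below and [a] the step length, so the Armijo test yields the drop
   [mu a s]. *)
pose s := 2^-1 * ((Lip R n)^-1 * ga).
have s0 : 0 < s by rewrite !mulr_gt0 ?invr_gt0 ?Lip_gt0.
pose a := Num.min 1 (delta * (s / (Lip R n * D))).
have a0 : 0 < a.
  by rewrite lt_min ltr01 mulr_gt0 // divr_gt0 // mulr_gt0 // Lip_gt0.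
exists (mu * (a * s)) => [|y k m g_bnd k0 arm arm_min].
  by rewrite mulr_gt0 // mulr_gt0.
have /andP[g_ge _] := g_bnd.
have g0 : gradphi G y != 0 by rewrite -vdot_gt0 (lt_le_trans ga0).
have s_le : s <= - vdot (gradphi G y) (newton_dir y k).
  apply: le_trans (newton_dir_descent y k k0 g0).
  by rewrite !ler_pM2l ?invr_gt0 ?Lip_gt0.
have a_le := armijo_step_ge y _ m s D s0 D0 s_le (hD y k g_bnd) arm_min.
apply: le_trans arm _; rewrite lerD2l -mulrA -mulrN ler_pM2l // -lerN2 opprK.
by rewrite -mulrN; apply: ler_pM => //; apply: ltW.
Qed.

End Decrease.

(** * Accumulation points and monotone real sequences *)

Lemma accum_point_sqr {R : realType} {n : nat} (y : nat -> vec R n) yh :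
  accum_point y yh -> forall e, 0 < e -> forall N,
  exists2 j, (N <= j)%N & vdot (y j - yh) (y j - yh) < e.
Proof.
move=> acc e e0 N; have r0 : 0 < Num.sqrt e by rewrite sqrtr_gt0.
have [j [Nj hj]] := acc _ r0 N; exists j => //.
by move: hj; rewrite ltr_sqrt.
Qed.

(** If [v = <kervec, yh>] were nonzero, every iterate would satisfy [<kervec, y j - yh> = - v] and
    so stay at squared distance at least [v^2 / q] from [yh]. *)
Lemma RanB_accum_point {R : realType} {n : nat} (y : nat -> vec R n) yh :
  (forall j, RanB (y j)) -> accum_point y yh -> RanB yh.
Proof.
move=> Ry acc; apply/RanBP; apply/eqP/negPn/negP => v0.
set v := vdot _ _ in v0; pose q := vdot (@kervec R n) kervec + 1.
have q0 : 0 < q by rewrite ltr_wpDl // vdot_ge0.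
have v2 : 0 < v ^+ 2 by rewrite exprn_even_gt0.
have [j _ hj] := accum_point_sqr _ _ acc (v ^+ 2 / q) (divr_gt0 v2 q0) 0%N.
have qi0 : 0 < q^-1 by rewrite invr_gt0.
have := vdot_young _ ((- v) *: @kervec R n) (y j - yh) qi0.
rewrite !(vdotZl, vdotZr) vdotBr -/v (RanBP _).1 // invrK => h.
rewrite ltr_pdivlMr // in hj.
have : q^-1 * (- v * (- v * vdot (@kervec R n) kervec)) <= v ^+ 2.
  rewrite ler_pdivrMl // /q; have := sqr_ge0 v; rewrite expr2; lra.
by rewrite expr2 in hj *; lra.
Qed.

(** By monotonicity the drops accumulate: [k] of them cost [c k], which by the Archimedean property
    eventually exceeds [f 0 - b]. *)
Lemma no_infinite_uniform_decrease {R : realType} (f : nat -> R) (b c : R) :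
  0 < c -> (forall j, b <= f j) -> (forall j, f j.+1 <= f j) ->
  ~ (forall N, exists2 j, (N <= j)%N & f j.+1 <= f j - c).
Proof.
move=> c0 f_ge f_mono dec.
have f_le i j : (i <= j)%N -> f j <= f i.
  by move/subnK <-; elim: (j - i)%N => // k; apply: le_trans; rewrite addSn.
have drop (k : nat) : exists j, f j <= f 0%N - c * k%:R.
  elim: k => [|k [i fi]]; first by exists 0%N; rewrite mulr0 subr0.
  have [j ij fj] := dec i; exists j.+1.
  by have := f_le _ _ ij; rewrite -natr1; lra.
have q_ge0 : 0 <= (f 0%N - b) / c by rewrite divr_ge0 ?subr_ge0 // ltW.
have [j] := drop (Num.bound ((f 0%N - b) / c)).
have := archi_boundP q_ge0; rewrite ltr_pdivrMr //; have := f_ge j; lra.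
Qed.

Theorem theorem3p2 (R : realType) (n : nat) (G : 'M[R]_n)
  (mu etabar tau1 tau2 tau delta : R)
  (hmu : 0 < mu < 2^-1) (heta : 0 < etabar < 1)
  (htau1 : 0 < tau1 < 1) (htau2 : 0 < tau2 < 1)
  (htau : 0 < tau <= 1) (hdelta : 0 < delta < 1)
  (y : nat -> 'cV[R]_(n + n))
  (hy : SSNCG1_seq G mu etabar tau1 tau2 tau delta y) :
  (forall j : nat, RanB (y j)) /\
  (exists M : R, forall j : nat, vnorm (y j) <= M) /\
  (forall yh : 'cV[R]_(n + n), accum_point y yh -> optimal G yh).
Proof.
have [Ry0 step] := hy.
have Ry j : RanB (y j).
  elim: j => // j Ryj; have [_ [[k ->] [_ [m [_ [_ ->]]]]]] := step j.
  apply: RanBD => //; apply: RanBZ; apply: RanB_cg_iter => [u|].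
    exact: RanB_Aj.
  by rewrite -scaleN1r; apply/RanBZ/RanB_gradphi.
have mono j : phi G (y j.+1) <= phi G (y j).
  have [_ [[k ->] [_ [m [arm [_ ->]]]]]] := step j.
  apply: le_trans arm _; rewrite gerDl mulr_ge0_le0 //.
    have /andP[mu0 _] := hmu; have /andP[d0 _] := hdelta.
    by rewrite ltW ?mulr_gt0 ?exprn_gt0.
  exact: newton_dir_nonascent.
split=> //; split.
  have [M hM] := phi_sublevel_bounded G (phi G (y 0%N)); exists M => j.
  by apply: hM => //; elim: j => // j; apply: le_trans.
move=> yh acc; apply: gradphi_eq0_optimal; first exact: RanB_accum_point acc.
apply/eqP/negPn/negP => gh0.
set gh := gradphi G yh in gh0; have q0 : 0 < vdot gh gh by rewrite vdot_gt0.
(* Some later iterate lies within distance 1 of [yh], where convexity and Young's inequality bound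
   [phi] below; monotonicity carries the bound back to [j]. *)
have phi_ge j : phi G yh - vdot gh gh - 1 <= phi G (y j).
  have [i ji hi] := accum_point_sqr _ _ acc 1 ltr01 j.
  apply: le_trans (_ : phi G (y i) <= _); last first.
    by rewrite -(subnK ji); elim: (i - j)%N => // k; apply: le_trans; rewrite addSn.
  have := phi_convex G yh (y i - yh); rewrite (addrC yh) subrK -/gh.
  have := vdot_young _ (- gh) (y i - yh) (ltr01 : 0 < 1 :> R).
  by rewrite !vdotNl vdotNr opprK invr1; lra.
have q4 : 0 < vdot gh gh / 4 by rewrite divr_gt0.
have [c c0 dec] := uniform_decrease G mu tau1 tau2 delta hmu htau1 htau2 hdelta
  (vdot gh gh / 4) (4 * vdot gh gh) q4.
apply: (no_infinite_uniform_decrease (fun j => phi G (y j)) _ _ c0 phi_ge mono).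
move=> N; have L2 : 0 < Lip R n ^+ 2 by rewrite exprn_gt0 ?Lip_gt0.
(* At squared distance below [|gh|^2 / (4 L^2)] the Lipschitz bound gives [|g - gh|^2 < |gh|^2 / 4],
   as [vdot_near] requires. *)
have [j Nj hj] := accum_point_sqr _ _ acc _ (divr_gt0 q4 L2) N; exists j => //.
rewrite ltr_pdivlMr // mulrC in hj.
have hd := le_lt_trans (gradphi_Lipschitz G (y j) yh) hj; rewrite -/gh in hd.
set g := gradphi G (y j) in hd *.
have g_bnd := vdot_near _ _ hd.
have g0 : g != 0.
  by move/andP: g_bnd => [g_ge _]; rewrite -vdot_gt0; exact: lt_le_trans g_ge.
have [_ [[k ->] [res [m [arm [arm_min ->]]]]]] := step j.
apply: dec => //; rewrite lt0n; apply/eqP => k0.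
(* A zero direction would leave the residual [||g||], but
   [||g|| <= min(etabar, ||g||^(1+tau))] with [etabar < 1] forces [g = 0]. *)
move: res; rewrite k0 /cg_iter /= -/g.
have -> : Aj tau1 tau2 G (y j) 0 = 0.
  have := AjDZ G (y j) tau1 tau2 0 0 (-1).
  by rewrite scaler0 addr0 scaleN1r subrr.
rewrite add0r le_min => /andP[g_eta g_pow].
have gp : 0 < vnorm g by rewrite sqrtr_gt0 vdot_gt0.
have g1 : vnorm g < 1 by apply: le_lt_trans g_eta _; case/andP: heta.
have t0 : 0 < tau by case/andP: htau.
(* Since [0 < |g| < 1] and [tau > 0], [|g|^(1 + tau) = |g| |g|^tau < |g|]. *)
move: g_pow; apply/negP; rewrite -ltNge powRD; last by rewrite (gt_eqF gp) implybT.
have p1 : powR 1 tau = 1 :> R by rewrite powR1.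
rewrite powRr1 ?(ltW gp) // gtr_pMr // -[ltRHS]p1.
by apply: gt0_ltr_powR; rewrite ?nnegrE ?(ltW gp).
Qed.
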